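(* Let $(X,\kappa)$ be a finite $\kappa$-connected digital image in $\mathbb{Z}$ and let $n\ge 1$ be an integer. Then $\mathrm{TC}_n(X,\kappa)=1$.
   Context: A digital image in $\mathbb{Z}$ is a finite subset $X\subset\mathbb{Z}$ with $\kappa=2$-adjacency: $x\leftrightarrow y$ iff $|x-y|=1$. It is $\kappa$-connected if any two distinct points are joined by a finite sequence of points of $X$ in which consecutive points are adjacent. In $X^n$, two distinct points are adjacent if in each coordinate their components are equal or adjacent. A map is digitally continuous if adjacent points have adjacent or equal images. The digital interval $[0,m]_{\mathbb{Z}}=\{0,\dots,m\}$ carries $2$-adjacency. Higher topological complexity. For a positive integer $n$, $J_n$ denotes the wedge of $n$ digital intervals $[0,m_1]_{\mathbb{Z}},\dots,[0,m_n]_{\mathbb{Z}}$ with the points $0_i\in[0,m_i]_{\mathbb{Z}}$ identified, the lengths $m_i$ being allowed to vary. An element $f\in X^{J_n}$ is a digitally continuous map $J_n\to X$, i.e. an $n$-tuple of digital paths in $X$ with a common starting point. Two elements of $X^{J_n}$ are adjacent if, after extending shorter paths by repeating their last points so that corresponding paths have equal lengths, their values are equal or adjacent at every point. Let $e_n:X^{J_n}\to X^n$, $e_n(f)=(f((m_1)_1),\dots,f((m_n)_n))$, the tuple of values at the $n$ endpoints. $\mathrm{TC}_n(X,\kappa)$ is the digital Schwarz genus of $e_n$: the minimum $k$ such that $X^n=U_1\cup\dots\cup U_k$ and for each $i$ there is a digitally continuous $s_i:U_i\to X^{J_n}$ with $e_n\circ s_i=\mathrm{id}_{U_i}$. *)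

(* Defs.v *)
From mathcomp Require Import all_boot all_order all_algebra.
From mathcomp Require Import finmap.

Set Implicit Arguments.
Unset Strict Implicit.
Unset Printing Implicit Defensive.

Import GRing.Theory Num.Theory.

(* Sets with an adjacency relation.  Besides digital images this also covers
   X^{J_n}, whose adjacency is reflexive; hence irreflexivity is not required. *)
Record digital := Digital {
  point :> Type;
  adj : point -> point -> Prop
}.

Definition adj_or_eq (A : digital) (x y : A) : Prop := adj x y \/ x = y.

Definition dcontinuous (A B : digital) (f : A -> B) : Prop :=
  forall x y : A, adj x y -> adj_or_eq (f x) (f y).

Definition dconnected (A : digital) : Prop :=
  forall x y : A, x <> y ->
    exists (l : nat) (c : nat -> A),
      [/\ c 0 = x, c l = y & forall t : nat, t < l -> adj (c t) (c t.+1)].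

Definition adjZ (x y : int) : Prop := (`|x - y| = 1)%R.

Definition dimageZ (X : {fset int}) : digital :=
  @Digital X (fun x y => adjZ (val x) (val y)).

Definition dinterval (m : nat) : digital :=
  @Digital 'I_m.+1 (fun s t => adjZ (Posz s) (Posz t)).

Definition dsub (A : digital) (U : A -> Prop) : digital :=
  @Digital {a : A | U a} (fun x y => adj (sval x) (sval y)).

Definition dpower (A : digital) (n : nat) : digital :=
  @Digital {ffun 'I_n -> A}
    (fun x y => x <> y /\ forall i : 'I_n, adj_or_eq (x i) (y i)).

Record dpath (A : digital) := DPath {
  plen : nat;
  pfun :> {ffun 'I_plen.+1 -> A};
  pfun_continuous : @dcontinuous (dinterval plen) A pfun
}.

(* The path p prolonged by repeating its last point. *)
Definition pext (A : digital) (p : dpath A) (t : nat) : A :=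
  p (inord (minn t (plen p))).

(* Maps J_n -> A: the restrictions to the n intervals (of arbitrary lengths)
   are paths that agree at the wedge point. *)
Record wedge_map (A : digital) (n : nat) := WedgeMap {
  arm : {ffun 'I_n -> dpath A};
  arm_start : forall i j : 'I_n, arm i ord0 = arm j ord0
}.

Definition dwedge (A : digital) (n : nat) : digital :=
  @Digital (wedge_map A n)
    (fun f g => forall (i : 'I_n) (t : nat),
       t <= maxn (plen (arm f i)) (plen (arm g i)) ->
       adj_or_eq (pext (arm f i) t) (pext (arm g i) t)).

Definition endpoints (A : digital) (n : nat) (f : dwedge A n) : dpower A n :=
  [ffun i => arm f i ord_max].

Definition has_section_cover (E B : digital) (p : E -> B) (k : nat) : Prop :=
  exists U : 'I_k -> B -> Prop,
    (forall b : B, exists i : 'I_k, U i b) /\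
    (forall i : 'I_k, exists s : dsub (U i) -> E,
       dcontinuous s /\ forall u : dsub (U i), p (s u) = sval u).

(* k is the minimum; a relation, since no finite cover need exist.  Covers have
   at least one member, which only matters when B is empty. *)
Definition is_schwarz_genus (E B : digital) (p : E -> B) (k : nat) : Prop :=
  [/\ 0 < k, has_section_cover p k &
      forall k' : nat, 0 < k' -> has_section_cover p k' -> k <= k'].

Definition is_TC (n : nat) (A : digital) (k : nat) : Prop :=
  is_schwarz_genus (@endpoints A n) k.

(* Main.v *)
Require Import Defs.
From mathcomp Require Import all_boot all_order all_algebra.
From mathcomp Require Import finmap.
From mathcomp Require Import zify.

(** A connected image [X] in the integers is an interval, so a point walking
    from a base point [a] straight towards a target [x], and stopping there,
    never leaves [X].  Its position after [t] steps is the projection of [x]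
    onto the interval from [a - t] to [a + t].  This projection moves by at
    most one when [t] moves by one, so the walk is a path; and it moves by at
    most one when [x] does, for every [t], so the walk depends continuously
    on [x].  Sending an [n]-tuple to the wedge of the walks from a fixed [a]
    to its components is therefore a continuous section of the endpoint map
    over the whole of [X^n], and one piece covers [X^n]. *)

Set Implicit Arguments.
Unset Strict Implicit.
Unset Printing Implicit Defensive.

Import Order.TTheory GRing.Theory Num.Theory.

Definition convexZ (X : {fset int}) : Prop :=
  forall u v w : int, u \in X -> v \in X -> (u <= w <= v)%R -> w \in X.

(** A discrete intermediate value theorem: steps of length one cannot pass from
    below [w] to above [w] without visiting [w]. *)
Lemma unit_steps_below (f : nat -> int) (w : int) (l : nat) :
  (forall t, t < l -> (`|f t - f t.+1| = 1)%R) -> (forall t, f t <> w) ->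
  (f 0 < w)%R -> (f l < w)%R.
Proof.
move=> + neq_w f0; elim: l => [//|l IHl] step.
have := IHl (fun t lt_tl => step t (ltnW lt_tl)).
by have := step l (ltnSn l); have := neq_w l.+1; lia.
Qed.

Lemma connected_convexZ (X : {fset int}) :
  dconnected (dimageZ X) -> convexZ X.
Proof.
move=> conX u v w uX vX /andP[le_uw le_wv]; apply/negPn/negP => wNX.
have neq_w (x : X) : val x <> w by move=> xw; rewrite -xw (valP x) in wNX.
have uw := neq_w [` uX]%fset; have vw := neq_w [` vX]%fset.
rewrite /= in uw vw.
have neq_uv : [` uX]%fset <> [` vX]%fset :> dimageZ X.
  by move=> /(congr1 val) /=; lia.
have [l [c [c0 cl step]]] := conX _ _ neq_uv.
have := @unit_steps_below (fun t => val (c t)) w l step (fun t => neq_w (c t)).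
by rewrite c0 cl /=; lia.
Qed.

Lemma adj_or_eqZ (X : {fset int}) (x y : dimageZ X) :
  adj_or_eq x y <-> (`|val x - val y| <= 1)%R.
Proof.
split=> [[|->]|le1]; rewrite /= /Defs.adjZ; [lia | lia |].
have [eq_xy|neq_xy] := eqVneq (val x) (val y); first by right; apply: val_inj.
by left; rewrite /= /Defs.adjZ; move: neq_xy le1; rewrite /=; lia.
Qed.

(** The projection of [x] onto the interval from [a - t] to [a + t]: this form
    covers both directions of travel. *)
Definition walkZ (a x : int) (t : nat) : int :=
  Num.max (a - t%:Z)%R (Num.min (a + t%:Z)%R x).

Lemma pext_plen (A : digital) (p : dpath A) : pext p (plen p) = p ord_max.
Proof. by rewrite /pext minnn; congr (p _); apply: val_inj; rewrite /= inordK. Qed.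

Lemma pext0 (A : digital) (p : dpath A) : pext p 0 = p ord0.
Proof. by rewrite /pext min0n; congr (p _); apply: val_inj; rewrite /= inordK. Qed.

Section Walk.

Variables (X : {fset int}) (a : X).
Hypothesis convX : convexZ X.

Lemma walkZ_in (x : X) (t : nat) : walkZ (val a) (val x) t \in X.
Proof.
have aX := valP a; have xX := valP x; rewrite /walkZ.
have [le_ax|lt_xa] := lerP (val a) (val x).
  by apply: (convX aX xX); lia.
by apply: (convX xX aX); lia.
Qed.

Definition walk_pt (x : X) (t : nat) : dimageZ X := [` walkZ_in x t]%fset.

Definition walk_fun (x : X) : {ffun 'I_(`|val x - val a|%N).+1 -> dimageZ X} :=
  [ffun t => walk_pt x (nat_of_ord t)].

Lemma walk_fun_continuous (x : X) :
  @dcontinuous (dinterval _) (dimageZ X) (walk_fun x).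
Proof.
move=> s t; rewrite /= /Defs.adjZ => st; apply/adj_or_eqZ.
by rewrite !ffunE /= /walkZ; lia.
Qed.

Definition walk (x : X) : dpath (dimageZ X) := DPath (@walk_fun_continuous x).

(** The stopped walk needs no case distinction between times before and after
    arrival, because the projection is already stationary after arrival. *)
Lemma val_pext_walk (x : X) (t : nat) :
  val (pext (walk x) t) = walkZ (val a) (val x) t.
Proof.
rewrite /pext /= ffunE /= inordK ?ltnS ?geq_minr //.
by rewrite /walkZ; lia.
Qed.

Lemma walk_start (x : X) : walk x ord0 = a.
Proof. by rewrite -pext0; apply: val_inj; rewrite val_pext_walk /walkZ; lia. Qed.

Lemma walk_end (x : X) : walk x ord_max = x.
Proof.
by rewrite -pext_plen; apply: val_inj; rewrite val_pext_walk /walkZ /=; lia.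
Qed.

Lemma walk_continuous (x y : dimageZ X) (t : nat) :
  adj_or_eq x y -> adj_or_eq (pext (walk x) t) (pext (walk y) t).
Proof.
by move=> /adj_or_eqZ xy; apply/adj_or_eqZ; rewrite !val_pext_walk /walkZ; lia.
Qed.

Variable n : nat.

Definition walks (x : dpower (dimageZ X) n) : {ffun 'I_n -> dpath (dimageZ X)} :=
  [ffun i => walk (x i)].

Lemma walksE (x : dpower (dimageZ X) n) (i : 'I_n) : walks x i = walk (x i).
Proof. by rewrite ffunE. Qed.

Lemma walks_start (x : dpower (dimageZ X) n) (i j : 'I_n) :
  walks x i ord0 = walks x j ord0.
Proof. by rewrite !walksE !walk_start. Qed.

Definition walk_section (x : dpower (dimageZ X) n) : dwedge (dimageZ X) n :=
  WedgeMap (walks_start x).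

Lemma walk_section_continuous : dcontinuous walk_section.
Proof.
move=> x y [_ xy]; left=> i t _.
by rewrite /= !walksE; apply: walk_continuous.
Qed.

Lemma endpoints_walk_section (x : dpower (dimageZ X) n) :
  endpoints (walk_section x) = x.
Proof. by apply/ffunP => i; rewrite ffunE /= walksE walk_end. Qed.

End Walk.

(** A section that is defined on all of [B] lifts the one-member cover. *)
Lemma section_genus1 (E B : digital) (p : E -> B) (s : B -> E) :
  dcontinuous s -> (forall b, p (s b) = b) -> is_schwarz_genus p 1.
Proof.
move=> s_cont sK; split=> //; exists (fun _ _ => True); split=> [b|i].
  by exists ord0.
exists (fun u => s (sval u)); split=> [x y xy|u]; last exact: sK.
exact: s_cont.
Qed.

Theorem theorem4p1 (X : {fset int}) (n : nat) :
  dconnected (dimageZ X) -> 0 < n -> is_TC n (dimageZ X) 1.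
Proof.
move=> /connected_convexZ convX n_gt0.
have [X0|[a aX]] := fset_0Vmem X.
  (* There is no base point, but for positive n there are no tuples either. *)
  have no_tuple (x : dpower (dimageZ X) n) : False.
    by have := valP (x (Ordinal n_gt0)); rewrite [in X in _ \in X]X0 in_fset0.
  by apply: (@section_genus1 _ _ _ (fun x => False_rect _ (no_tuple x))) => x;
    case: (no_tuple x).
apply: (@section_genus1 _ _ _ (@walk_section X [` aX]%fset convX n)).
  exact: walk_section_continuous.
exact: endpoints_walk_section.
Qed.
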